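(* Let $0<\mu<L_{\max}^{-1}$ with $L_{\max}=\max_i\|A_i\|_2^2$, let $\{x^n\}$ be generated by GAITA (as in the context) from an arbitrary $x^0\in\mathbf{R}^N$, and suppose $\{x^n\}$ converges to $x^*$. Let $I=Supp(x^* )$ and $K=\|x^*\|_0=|I|$. If $$A_I^TA_I+\lambda q(q-1)\Lambda(x_I^* )\succ0,$$ then $x^*$ is a strict local minimizer of $T_\lambda$.
   Context: Let $A\in\mathbf{R}^{m\times N}$ have columns $A_1,\dots,A_N$, $y\in\mathbf{R}^m$, $\lambda>0$, $q\in(0,1)$, and $T_\lambda(x)=\frac12\|Ax-y\|_2^2+\lambda\sum_{i=1}^N|x_i|^q$. For a step size $\mu>0$ set $\tau_{\mu,q}=\frac{2-q}{2-2q}(2\lambda\mu(1-q))^{\frac{1}{2-q}}$ and $\eta_{\mu,q}=(2\lambda\mu(1-q))^{\frac{1}{2-q}}$. For $z\in\mathbf{R}$ let $prox_{\mu,\lambda|\cdot|^q}(z)=\arg\min_{v\in\mathbf{R}}\{\frac{(z-v)^2}{2\mu}+\lambda|v|^q\}$ (a single point when $|z|\neq\tau_{\mu,q}$). Define $\mathcal{T}(z,w)$ as the unique element of $prox_{\mu,\lambda|\cdot|^q}(z)$ if $|z|\neq\tau_{\mu,q}$, and, if $|z|=\tau_{\mu,q}$, as $sgn(z)\eta_{\mu,q}$ when $w\neq0$ and $0$ when $w=0$. GAITA: given $x^0\in\mathbf{R}^N$, for $n=0,1,2,\dots$ let $i=(n\bmod N)+1$, $z_i^n=x_i^n-\mu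 A_i^T(Ax^n-y)$, $x_i^{n+1}=\mathcal{T}(z_i^n,x_i^n)$, $x_j^{n+1}=x_j^n$ for $j\neq i$. $Supp(x)=\{i:x_i\neq0\}$. $A_I$ is the submatrix of $A$ with columns indexed by $I$, $x_I^*$ the subvector of $x^*$ indexed by $I$, $\Lambda(x_I^* )\in\mathbf{R}^{K\times K}$ the diagonal matrix with diagonal entries $|x_i^*|^{q-2}$, $i\in I$, and $M\succ0$ means $M$ is positive definite. *)

(* Defs.v *)
From HB Require Import structures.
From mathcomp Require Import all_boot all_order all_algebra.
From mathcomp Require Import all_classical all_reals all_analysis.
Set Implicit Arguments. Unset Strict Implicit. Unset Printing Implicit Defensive.
Import Order.TTheory GRing.Theory Num.Theory.
Local Open Scope ring_scope.

Section GAITA.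
Variables (R : realType) (m N : nat).
Implicit Types (A : 'M[R]_(m, N)) (y : 'cV[R]_m) (x : 'cV[R]_N).

Definition Tlam A y (lam q : R) x : R :=
  2^-1 * (\sum_(k < m) ((A *m x) k 0 - y k 0) ^+ 2)
  + lam * \sum_(i < N) powR `|x i 0| q.

Definition colnorm2 A (i : 'I_N) : R := \sum_(k < m) (A k i) ^+ 2.
Definition Lmax A : R := \big[Num.max/0]_(i < N) colnorm2 A i.

Definition eta_mq (lam mu q : R) : R :=
  powR (2 * lam * mu * (1 - q)) (1 / (2 - q)).
Definition tau_mq (lam mu q : R) : R :=
  (2 - q) / (2 - 2 * q) * eta_mq lam mu q.

Definition is_prox (lam mu q z v : R) : Prop :=
  forall u : R, (z - v) ^+ 2 / (2 * mu) + lam * powR `|v| q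
                <= (z - u) ^+ 2 / (2 * mu) + lam * powR `|u| q.

(* v = T(z, w): when |z| <> tau the prox is a singleton and v is its element;
   when |z| = tau, v = sgn(z) eta if w <> 0 and 0 if w = 0. *)
Definition Tmap_rel (lam mu q z w v : R) : Prop :=
  (`|z| != tau_mq lam mu q /\ is_prox lam mu q z v) \/
  (`|z| = tau_mq lam mu q /\
     v = (if w != 0 then Num.sg z * eta_mq lam mu q else 0)).

Definition zcoord A y (mu : R) x (i : 'I_N) : R :=
  x i 0 - mu * \sum_(k < m) A k i * ((A *m x) k 0 - y k 0).

(* {x^n} is a GAITA sequence (from x^0 := x 0); index i = (n mod N)+1,
   written 0-based as n %% N. *)
Definition is_GAITA A y (lam mu q : R) (x : nat -> 'cV[R]_N) : Prop :=
  forall (n : nat) (j : 'I_N),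
    if (j : nat) == (n %% N)%N then
      Tmap_rel lam mu q (zcoord A y mu (x n) j) (x n j 0) (x n.+1 j 0)
    else x n.+1 j 0 = x n j 0.

Definition Supp x : {set 'I_N} := [set i | x i 0 != 0].

Definition subcols A (I : {set 'I_N}) : 'M[R]_(m, #|I|) :=
  \matrix_(k < m, j < #|I|) A k (enum_val j).

Definition LambdaI (q : R) x (I : {set 'I_N}) : 'M[R]_#|I| :=
  \matrix_(j, l < #|I|) (if j == l then powR `|x (enum_val j) 0| (q - 2) else 0).

End GAITA.

Definition posdef {R : realType} {n : nat} (M : 'M[R]_n) : Prop :=
  forall v : 'cV[R]_n, v != 0 -> 0 < (v^T *m M *m v) 0 0.

Definition strict_local_min {R : realType} {N : nat} (f : 'cV[R]_N -> R)
    (xs : 'cV[R]_N) : Prop :=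
  exists2 delta : R, 0 < delta &
    forall x : 'cV[R]_N, x != xs -> (forall i, `|x i 0 - xs i 0| < delta) ->
      f xs < f x.

(* Main.v *)
(** A nonzero output of the thresholding map is a critical point of the scalar
problem, also on the threshold [|z| = tau]. Since every coordinate is updated
infinitely often, in the limit [xs] satisfies the first-order condition of
[Tlam] on its support. Expand [Tlam (xs + h) - Tlam xs] to second order in the
coordinates of the support: the first-order part cancels, and the quadratic part
is coercive, by compactness of the unit sphere. In a coordinate off the support,
[lam * |h i|^q] with [q < 1] dominates the linear terms, which include the cross
terms of [|A h|^2]. *)
Require Import Defs.
From HB Require Import structures.
From mathcomp Require Import all_boot all_order all_algebra.
From mathcomp Require Import all_classical all_reals all_analysis.
From mathcomp Require Import ring lra.
Import Order.TTheory GRing.Theory Num.Theory.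
Import numFieldNormedType.Exports.
Local Open Scope classical_set_scope.
Local Open Scope ring_scope.

(** * Local lower bounds for scalar functions *)

(* Adding [e * h ^+ 2] makes the derivative of the remainder of the sign of
   [h] near [0]. *)
Lemma taylor2_ge (R : realType) (f g : R -> R) (a d e : R) :
  0 < e -> (\forall t \near a, is_derive (t : R) 1 f (g t)) -> is_derive a 1 g d ->
  \forall h \near 0, f a + g a * h + (d / 2 - e) * h ^+ 2 <= f (a + h).
Proof.
move=> e0 fg [dg gd].
have e20 : 0 < 2 * e by lra.
have := dg; rewrite /derivable -/(derive g a 1) => /cvg_ex[l gl].
have dl : d = l by rewrite -gd; exact: cvg_lim gl.
move: gl; rewrite -dl => /cvgrPdist_le /(_ _ e20).
case/nbhs_ballP => r1 /= r10 gr.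
case/nbhs_ballP: fg => r2 /= r20 fr.
near=> h.
have hr1 : `|h| < r1 by near: h; exact: cvgr0_norm_lt.
have hr2 : `|h| < r2 by near: h; exact: cvgr0_norm_lt.
(* [F] is the remainder along the segment from [a] to [a + h]: [F 0 = 0], and [F 1] is the quantity
   to be shown nonnegative. The mean value theorem leaves only the sign of [dF]. *)
pose F s := f (a + s * h) - (f a + g a * (s * h) + (d / 2 - e) * (s * h) ^+ 2).
pose dF s := (g (a + s * h) - (g a + (d - 2 * e) * (s * h))) * h.
have shE (s : R) : 0 <= s <= 1 -> `|s * h| <= `|h|.
  by case/andP=> s0 s1; rewrite normrM ger0_norm// ler_piMl.
have FdF (s : R) : 0 <= s <= 1 -> is_derive s 1 F (dF s).
  move=> s01.
  have D : is_derive (a + s * h) 1 f (g (a + s * h)).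
    apply: fr; rewrite -ball_normE /= opprD addrA subrr sub0r normrN.
    exact: le_lt_trans (shE _ s01) hr2.
  have D2 : is_derive s 1 (fun s : R => a + s * h) h.
    apply: is_derive_eq. rewrite /GRing.scale /=; ring.
  have := @is_derive1_comp _ f (fun s : R => a + s * h) s _ _ D D2.
  rewrite /F /comp /= => D3.
  apply: is_derive_eq. rewrite /dF /GRing.scale /=.
  by field.
have [||s s01] := @MVT _ F dF 0 1 ltr01.
- move=> s; rewrite in_itv/= => /andP[s0 s1].
  by apply: FdF; rewrite !ltW.
- apply: derivable_within_continuous => s; rewrite in_itv/= => s01.
  by have [] := FdF _ s01.
rewrite subr0 mulr1 => Fs.
suff : 0 <= dF s.
  rewrite -Fs /F !mul0r !mul1r addr0 expr0n /= !mulr0 !addr0 subrr subr0.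
  by rewrite subr_ge0.
move: s01; rewrite in_itv /= => /andP[s0 s1].
rewrite /dF; have [->|h0] := eqVneq h 0; first by rewrite mulr0.
(* After multiplication by [s > 0] the expression is the square of [s * h] times the difference
   quotient of [g] minus [d - 2 * e], and [gr] bounds that quotient from below by [d - 2 * e]. *)
rewrite -(pmulr_rge0 _ s0).
have sh0 : s * h != 0 by rewrite mulf_neq0 // gt_eqF.
have := gr (s * h); rewrite -ball_normE /= sub0r normrN => /(_ _ sh0).
have sh : `|s * h| <= `|h| by apply: shE; rewrite !ltW.
move=> /(_ (le_lt_trans sh hr1)).
rewrite /GRing.scale /= mulr1 (addrC _ a) ler_norml => /andP[H1 H2].
set G := g (a + s * h) - g a in H1 H2 *.
have Gk : (s * h)^-1 * G * (s * h) = G by rewrite mulrAC mulVf// mul1r.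
set k := (s * h)^-1 * G in H1 H2 Gk.
have -> : s * ((g (a + s * h) - (g a + (d - 2 * e) * (s * h))) * h)
    = (G - (d - 2 * e) * (s * h)) * (s * h).
  by rewrite /G; ring.
rewrite -Gk -mulrBl -mulrA -expr2 mulr_ge0 ?sqr_ge0//; lra.
Unshelve. all: by end_near. Qed.

(** The slope is written [q * |a|^q / a] so that one formula serves both signs of [a] and matches
    the stationarity equation multiplied by the coordinate. *)
Lemma powR_norm_taylor2_ge (R : realType) (q a e : R) :
  0 < e -> a != 0 ->
  \forall h \near 0, `|a| `^ q + q * `|a| `^ q / a * h
    + (q * (q - 1) / 2 * `|a| `^ (q - 2) - e) * h ^+ 2 <= `|a + h| `^ q.
Proof.
move=> e0.
have pos (b : R) : 0 < b -> \forall h \near 0, `|b| `^ q + q * `|b| `^ q / b * h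
    + (q * (q - 1) / 2 * `|b| `^ (q - 2) - e) * h ^+ 2 <= `|b + h| `^ q.
  move=> b0.
  have D1 : \forall t \near b, is_derive (t : R) 1 (fun u : R => u `^ q) (q * t `^ (q - 1)).
    near=> t; apply: is_derive1_powR.
    by near: t; exact: lt_nbhsr.
  have D2 : is_derive b 1 (fun t : R => q * t `^ (q - 1)) (q * (q - 1) * b `^ (q - 2)).
    have D := @is_derive1_powR R (q - 1) b b0.
    apply: is_derive_eq; rewrite /GRing.scale /= -mulrA.
    by congr (_ * (_ * powR _ _)); ring.
  have T := taylor2_ge _ _ _ _ _ _ e0 D1 D2.
  near=> h.
  have bh : 0 < b + h.
    have : `|h| < b by near: h; exact: cvgr0_norm_lt.
    rewrite ltr_norml => /andP[]; lra.
  rewrite !gtr0_norm//.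
  have : b `^ q + q * b `^ (q - 1) * h + (q * (q - 1) * b `^ (q - 2) / 2 - e) * h ^+ 2
    <= (b + h) `^ q by near: h.
  have -> : b `^ (q - 1) = b `^ q / b.
    by rewrite (@powRB _ b q 1) ?(gt_eqF b0) ?implybT // powRr1 ?ltW.
  by congr (_ <= _); field; rewrite gt_eqF.
rewrite neq_lt => /orP[a0|]; last exact: pos.
have := pos (- a); rewrite oppr_gt0 => /(_ a0).
(* For [a < 0], the bound at [- a] is read with [- h] in place of [h]. *)
rewrite -{1}oppr0 nearN.
apply: filterS => h.
by rewrite -opprD !normrN sqrrN invrN !mulrN mulNr opprK.
Unshelve. all: by end_near. Qed.
Lemma powR_norm_gt_linear_near0 (R : realType) (q k l : R) :
  q < 1 -> 0 < l ->
  \forall h \near (0 : R), h != 0 -> k * `|h| < l * `|h| `^ q.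
Proof.
move=> q1 l0.
have q10 : 0 < 1 - q by rewrite subr_gt0.
have [k0|k0] := lerP k 0.
  near=> h => h0; apply: (@le_lt_trans _ _ 0).
    by rewrite mulr_le0_ge0.
  by rewrite mulr_gt0 ?powR_gt0 ?normr_gt0.
near=> h => h0.
have h1 : 0 < `|h| by rewrite normr_gt0.
(* Below this radius [|h|^(1 - q) < l / k]; multiplying by [k * |h|^q] gives the claim. *)
have : `|h| < (l / k) `^ (1 - q)^-1.
  by near: h; apply: cvgr0_norm_lt => //; rewrite powR_gt0 ?divr_gt0.
move=> /(gt0_ltr_powR q10); rewrite !nnegrE powR_ge0 normr_ge0 => /(_ isT isT).
rewrite -powRrM mulVf ?gt_eqF// powRr1 ?divr_ge0 ?ltW// ltr_pdivlMr// => H.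
have -> : k * `|h| = `|h| `^ (1 - q) * k * `|h| `^ q.
  rewrite mulrAC -powRD ?(gt_eqF h1) ?implybT// subrK powRr1// ?ltW//.
  by rewrite mulrC.
by rewrite ltr_pM2r ?powR_gt0.
Unshelve. all: by end_near. Qed.

(** * Stationarity of the thresholding map *)

(* The stationarity equation is multiplied by [v]: it then also holds at
   [v = 0], and no sign function is left in it when passing to the limit. *)
Lemma is_prox_stationary (R : realType) (lam mu q z v : R) :
  0 < mu -> q != 0 -> is_prox lam mu q z v ->
  v * (v - z) + lam * mu * q * `|v| `^ q = 0.
Proof.
move=> mu0 q0.
have pos (w b : R) : 0 < b -> is_prox lam mu q w b ->
    b * (b - w) + lam * mu * q * `|b| `^ q = 0.
  move=> b0 pb.
  pose F (u : R) := (w - u) ^+ 2 / (2 * mu) + lam * u `^ q.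
  have DF (u : R) : 0 < u ->
      is_derive u 1 F ((u - w) / mu + lam * (q * u `^ (q - 1))).
    move=> u0; have D := @is_derive1_powR R q u u0.
    apply: is_derive_eq; rewrite /GRing.scale /=.
    by field; rewrite gt_eqF.
  have [dF F0] : is_derive b 1 F 0.
    (* This interval contains [b] and has only positive points, so it avoids the kink of [|u|^q] at
       [0]. *)
    apply: (@derive1_at_min _ _ 0 (2 * b)).
    - by rewrite mulr_ge0 ?ltW.
    - by move=> t; rewrite in_itv /= => /andP[t0 _]; have [] := DF _ t0.
    - by rewrite in_itv /= b0 /=; lra.
    - move=> t; rewrite in_itv /= => /andP[t0 _].
      by have := pb t; rewrite /F !gtr0_norm.
  have [_ F1] := DF _ b0.
  have := F0; rewrite F1 => E.
  have Eb : b `^ (q - 1) = b `^ q / b.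
    by rewrite (@powRB _ b q 1) ?(gt_eqF b0) ?implybT // powRr1 ?ltW.
  rewrite gtr0_norm//.
  transitivity (b * mu * ((b - w) / mu + lam * (q * b `^ (q - 1)))); last first.
    by rewrite E mulr0.
  by rewrite Eb; field; rewrite !gt_eqF.
have [->|] := eqVneq v 0.
  by rewrite mul0r normr0 powR0 // mulr0 addr0.
rewrite neq_lt => /orP[v0|v0] H; last exact: pos.
(* The prox problem is invariant under [(z, v) -> (- z, - v)], which reduces [v < 0] to the positive
   case. *)
rewrite -normrN.
have -> : v * (v - z) = - v * (- v - - z) by ring.
apply: pos; first by rewrite oppr_gt0.
move=> u; have := H (- u).
have sq t : (- z - t) ^+ 2 = (z + t) ^+ 2 by ring.
by rewrite !sq !normrN opprK.
Qed.

(** On the threshold the value is prescribed rather than given as a minimizer, so the equation is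
    checked by computation from [eta^(2 - q) = 2 * lam * mu * (1 - q)]. *)
Lemma Tmap_rel_stationary (R : realType) (lam mu q z w v : R) :
  0 < lam -> 0 < mu -> 0 < q -> q < 1 -> Tmap_rel lam mu q z w v ->
  v * (v - z) + lam * mu * q * `|v| `^ q = 0.
Proof.
move=> lam0 mu0 q0 q1 [[_ /is_prox_stationary]|[zt ->]].
  by apply=> //; rewrite gt_eqF.
case: (w != 0); last first.
  by rewrite mul0r normr0 powR0 ?gt_eqF // mulr0 addr0.
have b0 : 0 < 2 * lam * mu * (1 - q) by rewrite !mulr_gt0 // subr_gt0.
have e0 : 0 < eta_mq lam mu q by rewrite powR_gt0.
have eq2 : eta_mq lam mu q ^+ 2
    = 2 * lam * mu * (1 - q) * eta_mq lam mu q `^ q.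
  rewrite -powR_mulrn ?ltW //.
  rewrite -[X in _ `^ X = _](subrK q).
  rewrite powRD ?(gt_eqF e0) ?implybT //; congr (_ * _).
  rewrite /eta_mq -powRrM div1r mulVf ?powRr1 ?ltW//.
  by rewrite gt_eqF //; lra.
have t0 : 0 < `|z|.
  by rewrite zt /tau_mq mulr_gt0 // divr_gt0; lra.
rewrite normrM normr_sg -normr_gt0 t0 mul1r (gtr0_norm e0).
have zE : z = Num.sg z * tau_mq lam mu q by rewrite -zt mulr_sg_norm.
have s2 : Num.sg z * Num.sg z = 1.
  by rewrite -expr2 sqr_sg -normr_gt0 t0.
rewrite [X in _ - X]zE -mulrBr mulrACA s2 mul1r /tau_mq.
(* Here [1 - (2 - q) / (2 - 2 * q) = - q / (2 * (1 - q))], so by [eq2] the first term is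
   [- lam * mu * q * eta^q]. *)
transitivity (eta_mq lam mu q ^+ 2 * (1 - (2 - q) / (2 - 2 * q))
   + lam * mu * q * eta_mq lam mu q `^ q); first by ring.
rewrite eq2; field.
by rewrite gt_eqF; lra.
Qed.

(** * Coercivity of positive definite forms *)

Lemma cvg_sum (R : numFieldType) (V : normedModType R) (T : Type)
    (F : set_system T) {FF : Filter F} (n : nat) (f : 'I_n -> T -> V) (l : 'I_n -> V) :
  (forall i, f i t @[t --> F] --> l i) ->
  \sum_i f i t @[t --> F] --> \sum_i l i.
Proof.
move=> fl; apply: (cvg_big (op := +%R) (P := xpredT)) => //.
exact: add_continuous.
Qed.

(** The constant is the minimum of the form on the Euclidean unit sphere; homogeneity of degree two
    extends the bound to all vectors. Row vectors are used to fit [rV_compact] and [EVT_min_rV]. *)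
Lemma posdef_coercive (R : realType) (n : nat) (M : 'M[R]_n) :
  posdef M -> exists2 c, 0 < c &
    forall v : 'cV[R]_n, c * \sum_i v i 0 ^+ 2 <= (v^T *m M *m v) 0 0.
Proof.
move=> pM.
pose sq (w : 'rV[R]_n) := \sum_i w 0 i ^+ 2.
pose f (w : 'rV[R]_n) := (w *m M *m w^T) 0 0.
have coord i : continuous (fun w : 'rV[R]_n => w 0 i) by exact: coord_continuous.
have csq : continuous sq.
  by move=> w; apply: (@cvg_sum _ _ _ (nbhs w)) => i; apply: cvgM; exact: coord.
have cf : continuous f.
  rewrite (_ : f = fun w => \sum_i (\sum_j w 0 j * M j i) * w 0 i); last first.
    by apply/funext => w; rewrite /f mxE; apply: eq_bigr => i _; rewrite !mxE.
  move=> w; apply: (@cvg_sum _ _ _ (nbhs w)) => i; apply: cvgM; last exact: coord.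
  by apply: (@cvg_sum _ _ _ (nbhs w)) => j; apply: cvgM; [exact: coord|exact: cvg_cst].
have sq_ge0 w : 0 <= sq w by apply: sumr_ge0 => i _; exact: sqr_ge0.
have sq_eq0 w : sq w = 0 -> w = 0.
  move=> /psumr_eq0P w0; apply/rowP => i; rewrite mxE.
  by apply/eqP; rewrite -sqrf_eq0; apply/eqP/w0 => // j _; exact: sqr_ge0.
pose S := [set w | sq w = 1].
have cS : compact S.
  apply: (@subclosed_compact _ _ [set w : 'rV[R]_n | forall i, w ord0 i \in `[(-1 : R), 1]]).
  - apply: (@preimage_closed _ _ sq [set 1]); last exact: closed_eq.
    by move=> w _; exact: csq.
  - by apply: (@rV_compact _ _ (fun=> `[(-1 : R), 1]%classic)) => i; exact: segment_compact.
  - move=> w /= Sw i; rewrite /= in_itv /= -ler_norml.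
    rewrite -(@expr_le1 _ 2) // real_normK ?num_real // -Sw.
    by rewrite /sq (bigD1 i) //= lerDl sumr_ge0 // => j _; exact: sqr_ge0.
have key (v : 'cV[R]_n) : v != 0 -> S ((Num.sqrt (sq v^T))^-1 *: v^T).
  move=> v0; rewrite /S /= /sq.
  under eq_bigr do rewrite mxE exprMn.
  rewrite -mulr_sumr -/(sq v^T) exprVn sqr_sqrtr // mulVf //.
  by apply: contra v0 => /eqP/sq_eq0/(congr1 trmx); rewrite trmxK trmx0 => ->.
(* An empty sphere leaves only the zero vector, and any constant works. *)
have [S0|/set0P/negP/negPn/eqP S0] := pselect (S !=set0); last first.
  exists 1 => // v; have [->|/key] := eqVneq v 0; last by rewrite S0.
  rewrite mulmx0 mxE big1 ?mulr0 // => i _.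
  by rewrite mxE expr0n.
have [w wS wmin] := EVT_min_rV S0 cS (continuous_subspaceT cf).
have fw : 0 < f w.
  have := pM w^T; rewrite trmxK; apply; apply/eqP => /(congr1 trmx).
  rewrite trmxK trmx0 => w0; move: wS; rewrite inE /S /= w0 /sq big1 => [/eqP|i _].
    by rewrite eq_sym oner_eq0.
  by rewrite mxE expr0n.
exists (f w) => // v.
have [->|v0] := eqVneq v 0.
  rewrite mulmx0 mxE big1 ?mulr0 // => i _.
  by rewrite mxE expr0n.
have sv : 0 < sq v^T.
  rewrite lt_def sq_ge0 andbT; apply: contra v0 => /eqP/sq_eq0/(congr1 trmx).
  by rewrite trmxK trmx0 => ->.
have := wmin _ (mem_set (key _ v0)).
rewrite {2}/f linearZ /= -!scalemxAl -scalemxAr !mxE.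
rewrite mulrA -invfM -expr2 sqr_sqrtr ?(ltW sv) //.
rewrite ler_pdivlMl // mulrC trmxK; congr (_ * _ <= _).
by apply: eq_bigr => i _; rewrite mxE.
Qed.

(** * First-order condition at the limit *)

Definition gradLS {R : realType} {m N : nat} (A : 'M[R]_(m, N)) (y : 'cV[R]_m)
  (x : 'cV[R]_N) (i : 'I_N) : R := \sum_k A k i * ((A *m x) k 0 - y k 0).

Lemma GAITA_limit_stationary (R : realType) (m N : nat) (A : 'M[R]_(m, N))
    (y : 'cV[R]_m) (lam q mu : R) (x : nat -> 'cV[R]_N) (xs : 'cV[R]_N) (i : 'I_N) :
  0 < lam -> 0 < mu -> 0 < q -> q < 1 ->
  is_GAITA A y lam mu q x ->
  (forall i : 'I_N, (fun n => x n i 0) @ \oo --> xs i 0) ->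
  xs i 0 != 0 ->
  xs i 0 * gradLS A y xs i + lam * q * `|xs i 0| `^ q = 0.
Proof.
move=> lam0 mu0 q0 q1 gx cx xi0.
have N0 : (0 < N)%N by exact: leq_ltn_trans (ltn_ord i).
pose v n := x n.+1 i 0.
pose z n := zcoord A y mu (x n) i.
(* The times at which coordinate [i] is updated; the equation holds along them with the new value
   [v] and the [z] of the previous iterate, and both sequences converge. *)
pose s k := (k * N + i)%N.
have s_oo : s @ \oo --> \oo.
  apply: (@cvg_comp _ _ _ (muln^~ N) (addn^~ i)); last exact: cvg_addnr.
  exact: cvg_mulnr.
have vz k : v (s k) * (v (s k) - z (s k)) + lam * mu * q * `|v (s k)| `^ q = 0.
  apply: Tmap_rel_stationary (_ : Tmap_rel lam mu q _ (x (s k) i 0) _) => //.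
  have := gx (s k) i.
  by rewrite /s modnMDl modn_small // eqxx.
have vl : v @ \oo --> xs i 0 by have := cx i; rewrite -cvg_shiftS.
have zl : z @ \oo --> xs i 0 - mu * gradLS A y xs i.
  apply: cvgB; first exact: cx.
  apply: cvgM; first exact: cvg_cst.
  apply: cvg_sum => k; apply: cvgM; first exact: cvg_cst.
  apply: cvgB; last exact: cvg_cst.
  rewrite mxE; under eq_fun do rewrite mxE.
  by apply: cvg_sum => j; apply: cvgM; [exact: cvg_cst|exact: cx].
have cpow : {for xs i 0, continuous (fun t : R => `|t| `^ q)}.
  apply: (@continuous_comp _ _ _ (@Num.norm _ R) (fun t : R => t `^ q)).
    exact: norm_continuous.
  apply: differentiable_continuous; apply/derivable1_diffP.
  by apply: derivable_powR; rewrite in_itv /= normr_gt0 xi0.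
have wl : (fun n => v n * (v n - z n) + lam * mu * q * `|v n| `^ q) @ \oo -->
    xs i 0 * (xs i 0 - (xs i 0 - mu * gradLS A y xs i)) + lam * mu * q * `|xs i 0| `^ q.
  apply: cvgD; first by apply: cvgM => //; exact: cvgB.
  by apply: cvgM; [exact: cvg_cst|exact: (cvg_comp _ _ vl cpow)].
have := cvg_comp _ _ s_oo wl.
have -> : (fun n => v n * (v n - z n) + lam * mu * q * `|v n| `^ q) \o s = fun=> 0.
  by apply/funext => k; exact: vz.
move=> /(cvg_unique (@Rhausdorff R) (cvg_cst 0)) E.
(* The limit equation is [mu] times the required one. *)
apply: (mulfI (lt0r_neq0 mu0)); rewrite mulr0 [RHS]E.
ring.
Qed.

(** * Second-order analysis of [Tlam] *)

(** Reindexing by [enum_val] turns coercivity of the matrix on ['I_#|I|] into a bound on sums over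
    [I], the form in which the expansion of [Tlam] is estimated. *)
Lemma Hessian_coercive (R : realType) (m N : nat) (A : 'M[R]_(m, N)) (s q : R)
    (x : 'cV[R]_N) (I : {set 'I_N}) :
  posdef ((subcols A I)^T *m subcols A I + s *: LambdaI q x I) ->
  exists2 c, 0 < c & forall h : 'I_N -> R,
    c * \sum_(i in I) h i ^+ 2
    <= \sum_k (\sum_(i in I) A k i * h i) ^+ 2
       + s * \sum_(i in I) `|x i 0| `^ (q - 2) * h i ^+ 2.
Proof.
case/posdef_coercive=> c c0 cM; exists c => // h.
have := cM (\col_j h (enum_val j)).
set u := \col_j _ => H.
have uE j : u j 0 = h (enum_val j) by rewrite mxE.
have E1 : \sum_(i in I) h i ^+ 2 = \sum_j u j 0 ^+ 2.
  by rewrite big_enum_val; apply: eq_bigr => j _; rewrite uE.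
have E2 k : \sum_(i in I) A k i * h i = (subcols A I *m u) k 0.
  by rewrite big_enum_val mxE; apply: eq_bigr => j _; rewrite uE mxE.
have E3 : \sum_(i in I) `|x i 0| `^ (q - 2) * h i ^+ 2 = (u^T *m LambdaI q x I *m u) 0 0.
  rewrite big_enum_val mxE; apply: eq_bigr => j _.
  rewrite mxE (bigD1 j) //= big1 => [|l lj].
    by rewrite addr0 !mxE eqxx; ring.
  by rewrite !mxE (negPf lj) mulr0.
rewrite E1 E3; apply: le_trans H _.
under [X in _ <= X + _]eq_bigr do rewrite E2.
rewrite mulmxDr mulmxDl mxE -scalemxAr -scalemxAl [X in _ + X]mxE lerD2r.
rewrite mulmxA -mulmxA -trmx_mul mxE le_eqVlt; apply/orP; left; apply/eqP.
by apply: eq_bigr => k _; rewrite mxE expr2.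
Qed.

(** Exact, because the least-squares term is quadratic; the powers stay as differences, to be
    bounded coordinate by coordinate. *)
Lemma Tlam_expansion (R : realType) (m N : nat) (A : 'M[R]_(m, N)) (y : 'cV[R]_m)
    (lam q : R) (x h : 'cV[R]_N) :
  Tlam A y lam q (x + h) - Tlam A y lam q x
  = \sum_i (gradLS A y x i * h i 0
            + lam * (`|x i 0 + h i 0| `^ q - `|x i 0| `^ q))
    + 2^-1 * \sum_k (A *m h) k 0 ^+ 2.
Proof.
rewrite /Tlam big_split /= -mulr_sumr sumrB.
have -> : \sum_i `|(x + h) i 0| `^ q = \sum_i `|x i 0 + h i 0| `^ q.
  by apply: eq_bigr => i _; rewrite mxE.
have -> : \sum_i gradLS A y x i * h i 0 = \sum_k ((A *m x) k 0 - y k 0) * (A *m h) k 0.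
  under eq_bigr do rewrite mulr_suml.
  rewrite exchange_big; apply: eq_bigr => k _ /=.
  rewrite [(A *m h) k 0]mxE mulr_sumr; apply: eq_bigr => i _; ring.
have -> : \sum_k ((A *m (x + h)) k 0 - y k 0) ^+ 2 =
    \sum_k ((A *m x) k 0 - y k 0) ^+ 2
    + 2 * (\sum_k ((A *m x) k 0 - y k 0) * (A *m h) k 0)
    + \sum_k (A *m h) k 0 ^+ 2.
  rewrite mulr_sumr -!big_split; apply: eq_bigr => k _ /=.
  by rewrite mulmxDr [(A *m x + _) k 0]mxE; ring.
by field.
Qed.

(* Splitting [h] over [I] and its complement, only the cross term of
   [|A h|^2] can be negative, and it is linear in the part off [I]. *)
Lemma sqnorm_mulmx_split_ge (R : realType) (m N : nat) (A : 'M[R]_(m, N))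
    (I : {set 'I_N}) :
  exists C : 'I_N -> R, forall h : 'cV[R]_N, (forall i, `|h i 0| <= 1) ->
    \sum_k (\sum_(i in I) A k i * h i 0) ^+ 2 - \sum_(i in ~: I) C i * `|h i 0|
    <= \sum_k (A *m h) k 0 ^+ 2.
Proof.
(* With [u], [w] the parts of row [k] of [A h] on and off [I], [(u + w)^2 >= u^2 - 2 * |u| * |w|],
   and [|h i| <= 1] gives [|u| <= \sum_(j in I) |A k j|]. *)
exists (fun i => \sum_k 2 * (\sum_(j in I) `|A k j|) * `|A k i|) => h h1.
under [X in _ - X]eq_bigr do rewrite mulr_suml.
rewrite exchange_big -sumrB; apply: ler_sum => k _ /=.
have -> : (A *m h) k 0 = \sum_(i in I) A k i * h i 0 + \sum_(i in ~: I) A k i * h i 0.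
  rewrite mxE (bigID (mem I)) /=; congr (_ + _).
  by apply: eq_bigl => i; rewrite inE.
have uB : `|\sum_(i in I) A k i * h i 0| <= \sum_(j in I) `|A k j|.
  apply: le_trans (ler_norm_sum _ _ _) _; apply: ler_sum => i _.
  by rewrite normrM ler_piMr.
have wB : `|\sum_(i in ~: I) A k i * h i 0| <= \sum_(i in ~: I) `|A k i| * `|h i 0|.
  by apply: le_trans (ler_norm_sum _ _ _) _; apply: ler_sum => i _; rewrite normrM.
under [X in _ - X]eq_bigr do rewrite -!mulrA.
rewrite -!mulr_sumr.
set u := \sum_(i in I) A k i * h i 0 in uB *.
set w := \sum_(i in ~: I) A k i * h i 0 in wB *.
have := ler_pM (normr_ge0 _) (normr_ge0 _) uB wB.
rewrite -normrM ler_norml => /andP[H _].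
have := sqr_ge0 w; rewrite sqrrD mulr2n; lra.
Qed.

Lemma Tlam_second_order (R : realType) (m N : nat) (A : 'M[R]_(m, N)) (y : 'cV[R]_m)
    (lam q : R) (xs : 'cV[R]_N) :
  0 < lam -> 0 < q -> q < 1 ->
  (forall i, xs i 0 != 0 ->
     xs i 0 * gradLS A y xs i + lam * q * `|xs i 0| `^ q = 0) ->
  posdef ((subcols A (Supp xs))^T *m subcols A (Supp xs)
          + (lam * q * (q - 1)) *: LambdaI q xs (Supp xs)) ->
  strict_local_min (Tlam A y lam q) xs.
Proof.
move=> lam0 q0 q1 stat /Hessian_coercive[c c0 cH].
have [C CH] := @sqnorm_mulmx_split_ge R m N A (Supp xs).
(* The Taylor error then costs [lam * e * u2 = c / 4 * u2] out of the [c / 2 * u2] supplied by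
   coercivity. *)
pose e := c / (4 * lam).
have e0 : 0 < e by rewrite divr_gt0 // mulr_gt0.
(* Off the support, [K i] collects the linear terms: the gradient and half of the cross-term
   constant. *)
pose K i := `|gradLS A y xs i| + C i / 2.
pose P i (t : R) := [/\ `|t| <= 1,
  (xs i 0 != 0 -> `|xs i 0| `^ q + q * `|xs i 0| `^ q / xs i 0 * t
    + (q * (q - 1) / 2 * `|xs i 0| `^ (q - 2) - e) * t ^+ 2 <= `|xs i 0 + t| `^ q)
  & (t != 0 -> K i * `|t| < lam * `|t| `^ q)].
have [r r0 rP] : exists2 r : R, 0 < r & forall i (t : R), `|t| < r -> P i t.
  have : \forall t \near (0 : R), forall i, P i t.
    (* There are finitely many coordinates, so one radius serves them all. *)
    apply: (@filter_forall _ _ P (nbhs (0 : R))) => i.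
    have T : \forall t \near (0 : R), xs i 0 != 0 ->
        `|xs i 0| `^ q + q * `|xs i 0| `^ q / xs i 0 * t
        + (q * (q - 1) / 2 * `|xs i 0| `^ (q - 2) - e) * t ^+ 2 <= `|xs i 0 + t| `^ q.
      have [xi0|xi0] := eqVneq (xs i 0) 0; first by near=> t.
      by apply: filterS (powR_norm_taylor2_ge _ q _ _ e0 xi0) => t.
    near=> t; split; near: t => //.
    - exact: cvgr0_norm_le.
    - exact: powR_norm_gt_linear_near0.
  case/nbhs_ballP => r /= r0 rP; exists r => // i t tr.
  by apply: (rP t); rewrite -ball_normE /= sub0r normrN.
exists r => // x; rewrite -subr_eq0.
have [h ->] : exists h, x = xs + h by exists (x - xs); rewrite addrC subrK.
rewrite [_ - xs]addrC addKr => h0 hr.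
have {}hr i : `|h i 0| < r by have := hr i; rewrite mxE addrAC subrr add0r.
rewrite -subr_gt0 Tlam_expansion.
have h1 i : `|h i 0| <= 1 by have [] := rP i _ (hr i).
have := CH h h1; have := cH (fun i => h i 0).
set u2 := \sum_(i in Supp xs) h i 0 ^+ 2.
set Q := \sum_k (\sum_(i in _) _) ^+ 2.
set L := \sum_(i in Supp xs) _ * _.
set W := \sum_(i in _) C i * _.
move=> HQ HC.
rewrite (bigID (mem (Supp xs))) /=.
set SI := \sum_(i in Supp xs) _.
set SJ := \sum_(i | i \notin Supp xs) _.
have hSI : lam * q * (q - 1) / 2 * L - lam * e * u2 <= SI.
  rewrite /L /u2 !mulr_sumr -sumrB; apply: ler_sum => i; rewrite inE => xi0.
  have [_ /(_ xi0) T _] := rP i _ (hr i).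
  have := stat _ xi0 => /(canRL (addrK _)); rewrite sub0r => G.
  (* Stationarity makes the gradient cancel the first-order Taylor term. *)
  have {}G : gradLS A y xs i = - (lam * (q * `|xs i 0| `^ q / xs i 0)).
    by apply: (mulfI xi0); rewrite G; field.
  move: (ler_wpM2l (ltW lam0) T); rewrite -subr_ge0 => {}T.
  rewrite -subr_ge0 G; move: T.
  by congr (_ <= _); field.
(* What coordinate [i] off the support contributes once its share of the cross term is paid; by [D0]
   it vanishes only if [h i 0 = 0]. *)
pose D i := gradLS A y xs i * h i 0 + lam * (`|xs i 0 + h i 0| `^ q - `|xs i 0| `^ q)
  - C i * `|h i 0| / 2.
have q_neq0 := lt0r_neq0 q0.
have D0 i : i \notin Supp xs -> 0 <= D i ?= iff (h i 0 == 0).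
  rewrite inE negbK => /eqP xi0; rewrite /D xi0 normr0 powR0 // add0r subr0.
  have [->|hi0] := eqVneq (h i 0) 0.
    by apply/leifP; rewrite normr0 powR0 // !mulr0 mul0r subr0 addr0.
  apply/leifP.
  have [_ _ /(_ hi0)] := rP i _ (hr i).
  rewrite /K mulrDl -normrM.
  by have := ler_norm (- (gradLS A y xs i * h i 0)); rewrite normrN; lra.
have SJE : SJ = W / 2 + \sum_(i | i \notin Supp xs) D i.
  rewrite /W mulr_suml [X in X + _](eq_bigl (fun i => i \notin Supp xs)) => [|i]; last first.
    by rewrite inE.
  by rewrite -big_split; apply: eq_bigr => i _; rewrite /D /=; ring.
have u20 : 0 <= u2 by apply: sumr_ge0 => i _; exact: sqr_ge0.
have DS0 : 0 <= \sum_(i | i \notin Supp xs) D i.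
  by apply: sumr_ge0 => i /D0 [].
have le : lam * e = c / 4 by rewrite /e; field; rewrite lt0r_neq0.
(* Strictness: if both terms vanished, [h] would be zero on and off the support. *)
have pos : 0 < u2 + \sum_(i | i \notin Supp xs) D i.
  rewrite lt_def addr_ge0 // andbT paddr_eq0 //; apply: contra h0.
  case/andP=> /eqP/psumr_eq0P uz /eqP/psumr_eq0P Dz; apply/eqP/colP => i.
  rewrite mxE; have [iI|iI] := boolP (i \in Supp xs).
    by apply/eqP; rewrite -sqrf_eq0 uz // => j _; exact: sqr_ge0.
  apply/eqP; have [_ <-] := D0 _ iI; rewrite eq_sym Dz // => j /D0 [] //.
have cu : 0 <= c * u2 by rewrite mulr_ge0 // ltW.
have : 0 < c / 4 * u2 + \sum_(i | i \notin Supp xs) D i.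
  rewrite lt_def addr_ge0 ?mulr_ge0 ?divr_ge0 ?(ltW c0) //= andbT.
  rewrite paddr_eq0 ?mulr_ge0 ?divr_ge0 ?(ltW c0) // mulf_eq0 gt_eqF /=; last by lra.
  by move: pos; rewrite lt_def paddr_eq0 // => /andP[].
rewrite SJE le in hSI *; lra.
Unshelve. all: by end_near. Qed.

Theorem theorem5 (R : realType) (m N : nat) (A : 'M[R]_(m, N)) (y : 'cV[R]_m)
    (lam q mu : R) (x : nat -> 'cV[R]_N) (xs : 'cV[R]_N) :
  0 < lam -> 0 < q -> q < 1 ->
  0 < mu -> mu < (Lmax A)^-1 ->
  is_GAITA A y lam mu q x ->
  (forall i : 'I_N, (fun n => x n i 0) @ \oo --> xs i 0) ->
  posdef ((subcols A (Supp xs))^T *m subcols A (Supp xs)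
          + (lam * q * (q - 1)) *: LambdaI q xs (Supp xs)) ->
  strict_local_min (Tlam A y lam q) xs.
Proof.
move=> lam0 q0 q1 mu0 _ gx cx pM; apply: Tlam_second_order pM => // i.
exact: (GAITA_limit_stationary _ _ _ _ _ _ _ _ _ _ _ lam0 mu0 q0 q1 gx cx).
Qed.
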